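(* Let $\mathcal{C}$ be a decomposable class of graphs. Then $\mathcal{C}$ is intersectionwise $\chi$-guarding.
   Context: All graphs are finite and simple; graph classes are hereditary. The intersection (resp. union) of graphs $G_1,\dots,G_k$ is $(\bigcap V(G_i),\bigcap E(G_i))$ (resp. $(\bigcup V(G_i),\bigcup E(G_i))$). The graph-intersection of classes $\mathcal{G}_1,\dots,\mathcal{G}_k$ is the class of all graphs $G_1\cap\dots\cap G_k$ with $G_i\in\mathcal{G}_i$. A class is $\chi$-bounded if there is a non-decreasing $f:\mathbb{N}\to\mathbb{N}$ with $\chi(G)\le f(\omega(G))$ for all its members. A class $\mathcal{A}$ is intersectionwise $\chi$-guarding if for every $\chi$-bounded class $\mathcal{B}$ the graph-intersection of $\mathcal{A}$ and $\mathcal{B}$ is $\chi$-bounded. For an integer $r\ge 2$, a graph is componentwise $r$-dependent if every connected component has independence number at most $r-1$; the componentwise $r$-dependent chromatic number of $G$ is the least $k$ such that $V(G)$ can be partitioned into $k$ sets each inducing a componentwise $r$-dependent graph. A graph $G$ is $(t,k,r)$-decomposable if $G$ is the union of $t$ graphs each of componentwise $r$-dependent chromatic number at most $k$. A class $\mathcal{C}$ is decomposable if there exist positive integers $t,k,r$ (with $r\ge 2$) such that every graph in $\mathcal{C}$ is $(t,k,r)$-decomposable. *)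

(* Defs.v *)
From mathcomp Require Import all_boot finmap.

Set Implicit Arguments.
Unset Strict Implicit.
Unset Printing Implicit Defensive.

Local Open Scope fset_scope.

(* Intersections and unions of graphs depend on the actual vertices, so all
   graphs have their vertices in one fixed infinite set, namely nat; every
   finite graph is isomorphic to one of these. Edges are 2-element sets of
   vertices. The null graph is allowed: it is the intersection of any two
   vertex-disjoint graphs. *)
Definition wf_edges (V : {fset nat}) (E : {fset {fset nat}}) : bool :=
  all (fun e => (e `<=` V) && (#|` e| == 2)) E.

Record graph := Graph {
  vertices : {fset nat};
  edges : {fset {fset nat}};
  _ : wf_edges vertices edges
}.

Lemma graph_wf (G : graph) : wf_edges (vertices G) (edges G).
Proof. by case: G. Qed.

Definition adj (G : graph) (x y : nat) : bool := [fset x; y] \in edges G.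

Lemma adj_irrefl (G : graph) x : adj G x x = false.
Proof.
apply/negP => /(allP (graph_wf G)) /andP[_].
by rewrite cardfs2 eqxx.
Qed.

Lemma induced_wf (G : graph) (S : {fset nat}) :
  wf_edges (vertices G `&` S) [fset e in edges G | e `<=` S].
Proof.
apply/allP => e; rewrite !inE /= => /andP[eG eS].
by have /andP[eV ->] := allP (graph_wf G) e eG; rewrite fsubsetI eV eS.
Qed.
Definition induced (G : graph) (S : {fset nat}) : graph :=
  Graph (induced_wf G S).

Lemma graph_cap_wf (G H : graph) :
  wf_edges (vertices G `&` vertices H) (edges G `&` edges H).
Proof.
apply/allP => e; rewrite inE => /andP[eG eH].
have /andP[eVG ->] := allP (graph_wf G) e eG.
by have /andP[eVH _] := allP (graph_wf H) e eH; rewrite fsubsetI eVG eVH.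
Qed.
Definition graph_cap (G H : graph) : graph := Graph (graph_cap_wf G H).

Lemma graph_union_wf (t : nat) (G : 'I_t -> graph) :
  wf_edges (\bigcup_(i | true) vertices (G i)) (\bigcup_(i | true) edges (G i)).
Proof.
apply/allP => e /bigfcupP[i _ eG].
have /andP[eV ->] := allP (graph_wf (G i)) e eG; rewrite andbT.
by apply: fsubset_trans eV _; apply: bigfcup_sup; rewrite ?mem_index_enum.
Qed.
Definition graph_union (t : nat) (G : 'I_t -> graph) : graph :=
  Graph (graph_union_wf G).

Definition isomorphic (G H : graph) : Prop :=
  exists f : nat -> nat,
    [/\ {in vertices G &, injective f},
        [fset f x | x in vertices G] = vertices H
      & {in vertices G &, forall x y, adj H (f x) (f y) = adj G x y}].

Definition is_clique (G : graph) (S : {fset nat}) : bool :=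
  all (fun x => all (fun y => (x != y) ==> adj G x y) S) S.

Definition is_stable (G : graph) (S : {fset nat}) : bool :=
  all (fun x => all (fun y => ~~ adj G x y) S) S.

Definition clique_number (G : graph) : nat :=
  \max_(S <- fpowerset (vertices G) | is_clique G S) #|` S|.

Definition independence_number (G : graph) : nat :=
  \max_(S <- fpowerset (vertices G) | is_stable G S) #|` S|.

Definition proper_colouring (G : graph) (k : nat)
    (f : {ffun vertices G -> 'I_k}) : bool :=
  [forall x, forall y, adj G (val x) (val y) ==> (f x != f y)].

Definition colourable (G : graph) (k : nat) : bool :=
  [exists f : {ffun vertices G -> 'I_k}, proper_colouring f].

Lemma colourable_ex (G : graph) : exists k, colourable G k.
Proof.
exists #|{: vertices G}|; apply/existsP; exists [ffun x => enum_rank x].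
apply/forallP => x; apply/forallP => y; apply/implyP => xy.
rewrite !ffunE; apply: contraTneq xy => /enum_rank_inj ->.
by rewrite adj_irrefl.
Qed.

Definition chromatic_number (G : graph) : nat := ex_minn (colourable_ex G).

Definition adj_rel (G : graph) : rel (vertices G) :=
  fun x y => adj G (val x) (val y).

Definition component (G : graph) (x : vertices G) : graph :=
  induced G [fset val y | y : vertices G & connect (adj_rel (G := G)) x y].

Definition componentwise_dependent (r : nat) (G : graph) : bool :=
  [forall x : vertices G, independence_number (component x) <= r - 1].

(* A partition into k (possibly empty) sets is given by the function sending
   each vertex to the index of its part. *)
Definition part (G : graph) (k : nat) (f : {ffun vertices G -> 'I_k})
    (c : 'I_k) : {fset nat} :=
  [fset val x | x : vertices G & f x == c].

Definition cd_colourable (r : nat) (G : graph) (k : nat) : bool :=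
  [exists f : {ffun vertices G -> 'I_k},
    forall c, componentwise_dependent r (induced G (part f c))].

Lemma independence_number_le_card (G : graph) :
  independence_number G <= #|` vertices G|.
Proof.
apply/bigmax_leqP_seq => S; rewrite fpowersetE => SV _.
exact: fsubset_leq_card.
Qed.

Lemma cd_colourable_ex (r : nat) (r_ge2 : 2 <= r) (G : graph) :
  exists k, cd_colourable r G k.
Proof.
exists #|{: vertices G}|; apply/existsP; exists [ffun x => enum_rank x].
apply/forallP => c; apply/forallP => x.
apply: leq_trans (independence_number_le_card _) _.
apply: (@leq_trans 1); last by rewrite subn_gt0.
rewrite -(cardfs1 (val (enum_val c))); apply: fsubset_leq_card.
apply/fsubsetP => y /=; rewrite !inE => /andP[/andP[_ yc] _].
case/imfsetP: yc => z /=; rewrite !inE ffunE => /eqP zc ->.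
by rewrite -zc enum_rankK.
Qed.

(* The least number of parts exists only because r >= 2. *)
Definition cd_chromatic_number (r : nat) (r_ge2 : 2 <= r) (G : graph) : nat :=
  ex_minn (cd_colourable_ex r_ge2 G).

Definition tkr_decomposable (t k r : nat) (r_ge2 : 2 <= r) (G : graph) : Prop :=
  exists H : 'I_t -> graph,
    G = graph_union H /\ forall i, cd_chromatic_number r_ge2 (H i) <= k.

Definition graph_class := graph -> Prop.

Definition hereditary (C : graph_class) : Prop :=
  (forall G H, isomorphic G H -> C G -> C H) /\
  (forall G S, C G -> C (induced G S)).

Definition graph_intersection (A B : graph_class) : graph_class :=
  fun G => exists GA GB, [/\ A GA, B GB & G = graph_cap GA GB].

Definition chi_bounded (C : graph_class) : Prop :=
  exists f : nat -> nat,
    {homo f : m n / m <= n} /\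
    forall G, C G -> chromatic_number G <= f (clique_number G).

Definition intersectionwise_chi_guarding (A : graph_class) : Prop :=
  forall B, hereditary B -> chi_bounded B ->
    chi_bounded (graph_intersection A B).

Definition decomposable (C : graph_class) : Prop :=
  exists (t k r : nat) (r_ge2 : 2 <= r),
    [/\ 0 < t, 0 < k & forall G, C G -> tkr_decomposable t k r_ge2 G].

(* Main.v *)
(** If a graph [D] has independence number less than [r] and [B] has a clique
    inside [V(D)] of size [2 ^ (r + a)], then Ramsey's theorem applied to [D] on
    that clique yields a clique of size [a] in the intersection of [D] and [B].
    So, for every component [D] of a colour class of a piece of the
    decomposition, the restriction of [B] to [V(D)] has bounded clique number
    and hence bounded chromatic number. Colourings of these restrictions combine
    over the components of a class; pairing with the class index colours a
    piece, and the product of these colourings over the pieces colours the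
    union. *)
Require Import Defs.
From mathcomp Require Import all_boot finmap.

Set Implicit Arguments.
Unset Strict Implicit.
Unset Printing Implicit Defensive.

Local Open Scope fset_scope.

Lemma adj_sym (G : graph) x y : adj G x y = adj G y x.
Proof. by rewrite /adj fsetUC. Qed.

Lemma adj_vertices (G : graph) x y :
  adj G x y -> x \in vertices G /\ y \in vertices G.
Proof.
move=> /(allP (graph_wf G)) /andP[/fsubsetP sub _].
by split; apply: sub; rewrite !inE eqxx ?orbT.
Qed.

Lemma adj_induced (G : graph) S x y :
  adj (induced G S) x y = [&& adj G x y, x \in S & y \in S].
Proof. by rewrite /adj !inE /= fsubUset !fsub1set. Qed.

Lemma adj_cap (G H : graph) x y :
  adj (graph_cap G H) x y = adj G x y && adj H x y.
Proof. by rewrite /adj inE. Qed.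

Lemma adj_union t (H : 'I_t -> graph) x y :
  adj (graph_union H) x y -> exists i, adj (H i) x y.
Proof. by case/bigfcupP => i _ xy; exists i. Qed.

Definition subgraph (G H : graph) : Prop :=
  vertices G `<=` vertices H /\ edges G `<=` edges H.

Lemma subgraph_trans G H K : subgraph G H -> subgraph H K -> subgraph G K.
Proof.
by move=> [v e] [v' e']; split; [apply: fsubset_trans v' | apply: fsubset_trans e'].
Qed.

Lemma subgraph_adj G H x y : subgraph G H -> adj G x y -> adj H x y.
Proof. by case=> _ /fsubsetP; apply. Qed.

Lemma induced_subgraph G S : subgraph (induced G S) G.
Proof.
by split; apply/fsubsetP => x; rewrite !inE /= => /andP[].
Qed.

Lemma union_subgraph t (H : 'I_t -> graph) i : subgraph (H i) (graph_union H).
Proof. by split; apply: bigfcup_sup; rewrite ?mem_index_enum. Qed.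

Lemma cap_subgraph G H K : subgraph G H -> subgraph (graph_cap G K) (graph_cap H K).
Proof. by case=> v e; split; apply: fsetSI. Qed.

Lemma is_cliqueP (G : graph) (S : {fset nat}) :
  reflect {in S &, forall x y, x != y -> adj G x y} (is_clique G S).
Proof.
apply: (iffP allP) => [cl x y xS yS | cl x xS].
  by move/allP: (cl x xS) => /(_ y yS)/implyP.
by apply/allP => y yS; apply/implyP; apply: cl.
Qed.

Lemma is_stableP (G : graph) (S : {fset nat}) :
  reflect {in S &, forall x y, ~~ adj G x y} (is_stable G S).
Proof.
apply: (iffP allP) => [st x y xS yS | st x xS].
  by move/allP: (st x xS); apply.
by apply/allP => y; apply: st.
Qed.

Lemma clique_number_ge (G : graph) (S : {fset nat}) :
  S `<=` vertices G -> is_clique G S -> #|` S| <= clique_number G.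
Proof.
by move=> sub cl; apply: leq_bigmax_seq => //; rewrite fpowersetE.
Qed.

Lemma independence_number_ge (G : graph) (S : {fset nat}) :
  S `<=` vertices G -> is_stable G S -> #|` S| <= independence_number G.
Proof.
by move=> sub st; apply: leq_bigmax_seq => //; rewrite fpowersetE.
Qed.

Lemma clique_number_subgraph G H :
  subgraph G H -> clique_number G <= clique_number H.
Proof.
move=> sGH; apply/bigmax_leqP_seq => S; rewrite fpowersetE => SG /is_cliqueP cl.
apply: clique_number_ge; first exact: fsubset_trans SG sGH.1.
by apply/is_cliqueP => x y xS yS xy; apply: subgraph_adj sGH (cl _ _ _ _ _).
Qed.

(** Induction on [a + b]: a vertex [x] splits the rest of [S] into neighbours [N] and non-neighbours
    [M], and one of them keeps half of the bound. A clique found in [N] or a stable set found in [M]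
    is then extended by [x]. *)
Lemma ramsey (G : graph) (a b : nat) (S : {fset nat}) : 2 ^ (a + b) <= #|` S| ->
  exists2 Q : {fset nat}, Q `<=` S &
    (is_clique G Q /\ #|` Q| = a) \/ (is_stable G Q /\ #|` Q| = b).
Proof.
have [n] := ubnP (a + b); elim: n a b S => // n IHn [|a] [|b] S abn SN.
1-3: exists fset0; rewrite ?fsub0set ?cardfs0 //.
- by left; split=> //; apply/is_cliqueP => x.
- by left; split=> //; apply/is_cliqueP => x.
- by right; split=> //; apply/is_stableP => x.
have [S0|[x xS]] := fset_0Vmem S.
  by move: SN; rewrite S0 cardfs0 leqn0 expn_eq0.
pose N := [fset y in S `\ x | adj G x y].
pose M := [fset y in S `\ x | ~~ adj G x y].
have NMS : #|` S| = (#|` N| + #|` M|).+1.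
  rewrite (cardfsD1 x S) xS add1n -(cardfsID N (S `\ x)); congr (_ + _).+1.
    by congr #|` _|; apply/fsetP => y; rewrite !inE /=; case: (y == x); case: (y \in S).
  congr #|` _|; apply/fsetP => y; rewrite !inE /=.
  by case: (y == x); case: (y \in S); case: (adj _ _ _).
(* Both thresholds are half of the bound on [S]. If [N] misses it, then [N] and [x] together fill at
   most one half, which leaves the other to [M]. *)
have : (2 ^ (a + b.+1) <= #|` N|) || (2 ^ (a.+1 + b) <= #|` M|).
  rewrite -implyNb -ltnNge; apply/implyP => small.
  move: SN; rewrite NMS addSn expnS mul2n -addnn addSnnS => big.
  rewrite -(leq_add2l (2 ^ (a + b.+1))) (leq_trans big) // -addSn.
  by rewrite leq_add2r.
have abn' : a.+1 + b < n by rewrite addnS in abn.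
case/orP => [/(IHn _ _ _ abn)[Q QN]|/(IHn _ _ _ abn')[Q QM]].
- have subx : x |` Q `<=` S.
    rewrite fsubUset fsub1set xS; apply/fsubsetP => y /(fsubsetP QN).
    by rewrite !inE /= => /andP[/andP[]].
  have xQ : x \notin Q by apply/negP => /(fsubsetP QN); rewrite !inE eqxx.
  case=> -[cl card]; last first.
    by exists Q; [apply: fsubset_trans subx; apply: fsubsetU1 | right].
  exists (x |` Q) => //; left; rewrite cardfsU1 xQ card; split=> //.
  have xadj y : y \in Q -> adj G x y.
    by move/(fsubsetP QN); rewrite !inE /= => /andP[].
  apply/is_cliqueP => y z; rewrite !inE.
  case/orP=> [/eqP->|yQ] /orP[/eqP->|zQ]; rewrite ?eqxx // => yz.
  + exact: xadj.
  + by rewrite adj_sym xadj.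
  + by apply: (is_cliqueP _ _ cl).
have subx : x |` Q `<=` S.
  rewrite fsubUset fsub1set xS; apply/fsubsetP => y /(fsubsetP QM).
  by rewrite !inE /= => /andP[/andP[]].
have xQ : x \notin Q by apply/negP => /(fsubsetP QM); rewrite !inE eqxx.
case=> -[st card].
  by exists Q; [apply: fsubset_trans subx; apply: fsubsetU1 | left].
exists (x |` Q) => //; right; rewrite cardfsU1 xQ card; split=> //.
have xadj y : y \in Q -> ~~ adj G x y.
  by move/(fsubsetP QM); rewrite !inE /= => /andP[].
apply/is_stableP => y z; rewrite !inE.
case/orP=> [/eqP->|yQ] /orP[/eqP->|zQ]; rewrite ?adj_irrefl //.
- exact: xadj.
- by rewrite adj_sym xadj.
- by apply: (is_stableP _ _ st).
Qed.

Lemma clique_number_induced_le (D B : graph) (r : nat) :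
  independence_number D < r ->
  clique_number (induced B (vertices D))
    <= 2 ^ ((clique_number (graph_cap D B)).+1 + r).
Proof.
move=> Dr; apply/bigmax_leqP_seq => S; rewrite fpowersetE /= fsubsetI.
case/andP => SB SD /is_cliqueP clS; rewrite leqNgt; apply/negP => /ltnW.
(* A stable set of size [r] contradicts [Dr]. The other outcome is a clique of [D] inside the clique
   [S] of [B], hence a clique of the intersection that is one vertex too large. *)
case/(@ramsey D) => Q QS [[/is_cliqueP cl card]|[st card]]; last first.
  have := independence_number_ge (fsubset_trans QS SD) st.
  by rewrite card leqNgt Dr.
suff : #|` Q| <= clique_number (graph_cap D B) by rewrite card ltnn.
apply: clique_number_ge.
  by rewrite fsubsetI !(fsubset_trans QS).
apply/is_cliqueP => x y xQ yQ xy; rewrite adj_cap cl //=.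
have := clS _ _ (fsubsetP QS _ xQ) (fsubsetP QS _ yQ) xy.
by rewrite adj_induced => /andP[].
Qed.

(** Colourings are total on [nat], so those of different graphs combine without casts between vertex
    types. *)
Definition proper (T : eqType) (e : rel nat) (c : nat -> T) : Prop :=
  forall x y, e x y -> c x != c y.

Lemma chromatic_number_le_card (G : graph) (T : finType) (c : nat -> T) :
  proper (adj G) c -> chromatic_number G <= #|T|.
Proof.
move=> pc; rewrite /chromatic_number; case: ex_minnP => k _; apply.
apply/existsP; exists [ffun x => enum_rank (c (val x))].
apply/forallP => x; apply/forallP => y; apply/implyP => xy.
by rewrite !ffunE; apply: contraNneq (pc _ _ xy) => /enum_rank_inj ->.
Qed.

(* The extra colour serves as a value outside the vertex set. *)
Lemma proper_exists (G : graph) m : chromatic_number G <= m ->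
  exists c : nat -> 'I_m.+1, proper (adj G) c.
Proof.
rewrite /chromatic_number; case: ex_minnP => k /existsP[f pf] _ km.
exists (fun x => if insub x is Some v then widen_ord (leqW km) (f v) else ord0).
move=> x y xy; have [xG yG] := adj_vertices xy.
rewrite !insubT /= -val_eqE /=.
by move/forallP: pf => /(_ [` xG])/forallP/(_ [` yG])/implyP; apply.
Qed.

Lemma component_subgraph G (x : vertices G) : subgraph (component x) G.
Proof. exact: induced_subgraph. Qed.

(** No edge of [L] joins two components, so colourings chosen independently for the components can
    share one palette. *)
Lemma proper_glue (L B : graph) m :
  (forall x : vertices L,
     chromatic_number (induced B (vertices (component x))) <= m) ->
  exists c : nat -> 'I_m.+1, proper (adj (graph_cap L B)) c.
Proof.
move=> bound; have [c pc] := fin_all_exists (fun x => proper_exists (bound x)).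
have sym : connect_sym (adj_rel (G := L)).
  by apply: sym_connect_sym => x y; rewrite /adj_rel adj_sym.
(* The root is a canonical representative, so all vertices of a component use the same colouring. *)
exists (fun u => if insub u is Some v then c (root (adj_rel (G := L)) v) u
                 else ord0).
move=> x y; rewrite adj_cap => /andP[xyL xyB].
have [xL yL] := adj_vertices xyL; rewrite !insubT /=.
have xy : connect (adj_rel (G := L)) [` xL] [` yL] by apply: connect1.
have root_xy : root (adj_rel (G := L)) [` xL] = root (adj_rel (G := L)) [` yL].
  by apply/eqP; rewrite (root_connect sym).
rewrite -root_xy; apply: pc; rewrite adj_induced xyB /=.
have mem v (vL : v \in vertices L) :
    root (adj_rel (G := L)) [` vL] = root (adj_rel (G := L)) [` xL] ->
    v \in vertices (component (root (adj_rel (G := L)) [` xL])).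
  move=> <-; rewrite !inE vL /=; apply/imfsetP; exists [` vL] => //=.
  by rewrite inE sym connect_root.
by rewrite !(mem, mem x xL).
Qed.

(** The first coordinate names the part. If it agrees at both ends of an edge, the edge lies within
    one part, whose glued colouring separates the ends. *)
Lemma proper_cd_colourable (r k m : nat) (H B : graph) :
  0 < r -> cd_colourable r H k ->
  (forall D, subgraph D H -> independence_number D < r ->
     chromatic_number (induced B (vertices D)) <= m) ->
  exists c : nat -> 'I_k.+1 * 'I_m.+1, proper (adj (graph_cap H B)) c.
Proof.
move=> r0 /existsP[f /forallP cdf] bound.
have /fin_all_exists[c pc] (i : 'I_k) : exists c : nat -> 'I_m.+1,
    proper (adj (graph_cap (induced H (part f i)) B)) c.
  apply: proper_glue => x; apply: bound.
    exact: subgraph_trans (component_subgraph x) (induced_subgraph _ _).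
  by move/forallP: (cdf i) => /(_ x); rewrite subn1 -ltnS prednK.
(* The palette ['I_k.+1] provides a default outside [H] even when [k] is zero. *)
exists (fun u => if insub u is Some v then (widen_ord (leqnSn k) (f v), c (f v) u)
                 else (ord0, ord0)).
move=> x y; rewrite adj_cap => /andP[xyH xyB].
have [xH yH] := adj_vertices xyH; rewrite !insubT /= xpair_eqE -val_eqE /= val_eqE.
rewrite negb_and -implybE; apply/implyP => /eqP fxy; rewrite -fxy; apply: pc.
rewrite adj_cap adj_induced xyH xyB andbT /=.
by apply/andP; split; apply/imfsetP; [exists [` xH] | exists [` yH]];
  rewrite //= inE ?fxy.
Qed.

Theorem theorem3p1 (C : graph_class) (hC : hereditary C)
    (dC : decomposable C) : intersectionwise_chi_guarding C.
Proof.
move=> B [_ hB] [f [homof boundf]]; case: dC => t [k [r [r2 [t0 _ dec]]]].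
have r0 : 0 < r by apply: ltnW.
(* [m w] bounds the chromatic number of [GB] restricted to a component: [f] at the Ramsey bound. *)
pose m w := f (2 ^ (w.+1 + r)).
exists (fun w => (k.+1 * (m w).+1) ^ t); split.
  move=> w w' ww'; rewrite leq_exp2r // leq_mul2l /= ltnS homof //.
  by rewrite leq_pexp2l // leq_add2r.
move=> _ [GA [GB [/dec[H [-> cdH]] BGB ->]]].
set w := clique_number _.
have /fin_all_exists[c pc] (i : 'I_t) : exists c : nat -> 'I_k.+1 * 'I_(m w).+1,
    proper (adj (graph_cap (H i) GB)) c.
  have := cdH i; rewrite /cd_chromatic_number; case: ex_minnP => k' cdk' _ k'k.
  have [|c pc] := proper_cd_colourable (m := m w) (B := GB) r0 cdk'.
    (* Heredity keeps the restriction of [GB] in [B]. As [D] lies in the union, its intersection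
       with [GB] has clique number at most [w]. *)
    move=> D DH Dr; apply: leq_trans (boundf _ (hB _ _ BGB)) _; apply: homof.
    apply: leq_trans (clique_number_induced_le GB Dr) _.
    rewrite leq_pexp2l // leq_add2r ltnS; apply: clique_number_subgraph.
    exact: cap_subgraph (subgraph_trans DH (union_subgraph H i)).
  (* The number [k'] of parts depends on the piece; widening gives all pieces one colour type. *)
  exists (fun x => (widen_ord (k'k : k'.+1 <= k.+1) (c x).1, (c x).2)) => x y /pc.
  by rewrite !xpair_eqE.
(* An edge of the union lies in some piece [H i], and coordinate [i] alone separates its ends. *)
pose col x := [ffun i => c i x].
have /chromatic_number_le_card : proper (adj (graph_cap (graph_union H) GB)) col.
  move=> x y; rewrite adj_cap => /andP[/adj_union[i xyH] xyB].
  apply/eqP => /ffunP/(_ i); rewrite !ffunE; apply/eqP; apply: pc.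
  by rewrite adj_cap xyH.
by rewrite card_ffun card_prod !card_ord.
Qed.
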